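(* Let $H$ be a finitely generated normal subgroup of a finitely generated group $\Gamma$, and let $\alpha:\Gamma\to\Gamma$ be a group endomorphism such that $\alpha(H)\subset H$. Then $$GR(\alpha\text{ on }\Gamma/H)\le GR(\alpha).$$
   Context: For a group $G$ with finite generating set $T$ and $g\in G$, $|g|_T$ denotes the length of the shortest word in the letters $T\cup T^{-1}$ representing $g$. The growth rate of an endomorphism $\beta:G\to G$ is $GR(\beta)=\sup_{g\in G}\ \limsup_{m\to\infty}\sqrt[m]{|\beta^m(g)|_T}$. $GR(\alpha\text{ on }\Gamma/H)$ is the growth rate of the endomorphism of $\Gamma/H$ induced by $\alpha$. *)

(* Defs.v *)
From HB Require Import structures.
From mathcomp Require Import all_boot all_order all_algebra finmap generic_quotient.
From mathcomp Require Import all_classical all_reals all_analysis.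

Set Implicit Arguments.
Unset Strict Implicit.
Unset Printing Implicit Defensive.

Local Open Scope group_scope.
Local Open Scope quotient_scope.

Section Words.
Variable G : groupType.
Implicit Types (T : {fset G}) (A : {pred G}) (w : seq G) (g : G).

(* The letters of a word over T are the elements of T and their inverses. *)
Definition is_word T w : bool := all (fun x => (x \in T) || (x^-1 \in T)) w.

Definition word_val w : G := \prod_(x <- w) x.

Definition generates T A : Prop :=
  forall g, g \in A <-> exists2 w, is_word T w & word_val w = g.

Definition finitely_generated A : Prop := exists T, generates T A.

End Words.

Record genset (G : groupType) := Genset {
  genset_fset :> {fset G};
  gensetP : generates genset_fset predT }.

Section Length.
Variables (G : groupType) (T : genset G).

Definition has_word_of_size (g : G) (n : nat) : bool :=
  `[< exists w, [/\ is_word T w, word_val w = g & size w = n] >].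

Lemma has_word_of_sizeP g : exists n, has_word_of_size g n.
Proof.
have [w Tw wg] := (gensetP T g).1 isT.
by exists (size w); apply/asboolP; exists w.
Qed.

Definition word_length (g : G) : nat := ex_minn (has_word_of_sizeP g).

End Length.

(* The supremum and the limsup are taken in the extended reals, where they
   always exist. The m-th root is the power 1/m; the term m = 0, where m^-1 = 0,
   is irrelevant to the limsup. *)
Definition growth_rate (R : realType) (G : groupType) (T : genset G)
    (b : UMagmaMorphism.type G G) : \bar R :=
  ereal_sup [set limn_esup
    (fun m : nat => ((word_length T (iter m b g))%:R `^ (m%:R^-1))%R%:E) | g in [set: G]].

(* Subgroups are boolean predicates, as in the library's [groupClosed]; in the
   classical setting of this file every subset is one, via [asbool]. *)
HB.mixin Record isNormalClosed (G : groupType) (H : {pred G}) := {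
  normalJ : forall x y : G, x \in H -> x ^ y \in H }.

#[short(type="normalSubgroup")]
HB.structure Definition NormalSubgroup (G : groupType) :=
  {H of GroupClosed G H & isNormalClosed G H}.

Section Quotient.
Variables (G : groupType) (H : normalSubgroup G).

Definition eqv_mod (x y : G) : bool := x^-1 * y \in (H : {pred G}).

Lemma eqv_mod_refl : reflexive eqv_mod.
Proof. by move=> x; rewrite /eqv_mod mulVg gpred1. Qed.

Lemma eqv_mod_sym : symmetric eqv_mod.
Proof. by move=> x y; rewrite /eqv_mod -[in RHS]gpredV invgM invgK. Qed.

Lemma eqv_mod_trans : transitive eqv_mod.
Proof.
move=> y x z; rewrite /eqv_mod => xy yz.
have -> : x^-1 * z = (x^-1 * y) * (y^-1 * z) by rewrite mulgA mulgK.
by rewrite gpredM.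
Qed.

Canonical eqv_mod_equiv := EquivRel eqv_mod eqv_mod_refl eqv_mod_sym eqv_mod_trans.

Definition quot_group := {eq_quot eqv_mod}.

HB.instance Definition _ := Choice.on quot_group.
HB.instance Definition _ := EqQuotient.on quot_group.

Definition quot_mul (c d : quot_group) : quot_group :=
  \pi_quot_group (repr c * repr d).
Definition quot_one : quot_group := \pi_quot_group 1.
Definition quot_inv (c : quot_group) : quot_group :=
  \pi_quot_group (repr c)^-1.

Lemma quot_eqP (x y : G) :
  reflect (\pi_quot_group x = \pi_quot_group y) (x^-1 * y \in (H : {pred G})).
Proof. exact: (@eqmodP G eqv_mod_equiv x y). Qed.

Lemma repr_quot (x : G) : x^-1 * repr (\pi_quot_group x) \in (H : {pred G}).
Proof. by apply/quot_eqP; rewrite reprK. Qed.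

Lemma quot_mulE (x y : G) :
  quot_mul (\pi_quot_group x) (\pi_quot_group y) = \pi_quot_group (x * y).
Proof.
apply/esym/quot_eqP.
set x' := repr _; set y' := repr _.
have -> : (x * y)^-1 * (x' * y') = (x^-1 * x') ^ y * (y^-1 * y').
  by rewrite /conjg invgM !mulgA mulgK.
by rewrite gpredM ?normalJ ?repr_quot.
Qed.

Lemma quot_invE (x : G) : quot_inv (\pi_quot_group x) = \pi_quot_group x^-1.
Proof.
apply/esym/quot_eqP.
set x' := repr _; rewrite invgK -gpredV.
have -> : (x / x')^-1 = (x^-1 * x') ^ x^-1.
  by rewrite /conjg invgM !invgK !mulgA mulgV mul1g.
by rewrite normalJ ?repr_quot.
Qed.

Fact quot_mulA : associative quot_mul.
Proof.
move=> a b c; rewrite -(reprK a) -(reprK b) -(reprK c).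
by rewrite (quot_mulE (repr b) (repr c)) (quot_mulE (repr a) (repr b))
  !quot_mulE mulgA.
Qed.

Fact quot_mul1g : left_id quot_one quot_mul.
Proof. by move=> a; rewrite -(reprK a) quot_mulE mul1g. Qed.

Fact quot_mulg1 : right_id quot_one quot_mul.
Proof. by move=> a; rewrite -(reprK a) quot_mulE mulg1. Qed.

Fact quot_mulVg : left_inverse quot_one quot_inv quot_mul.
Proof. by move=> a; rewrite -(reprK a) quot_invE quot_mulE mulVg. Qed.

Fact quot_mulgV : right_inverse quot_one quot_inv quot_mul.
Proof. by move=> a; rewrite -(reprK a) quot_invE quot_mulE mulgV. Qed.

HB.instance Definition _ := isGroup.Build quot_group
  quot_mulA quot_mul1g quot_mulg1 quot_mulVg quot_mulgV.

Lemma quot_pi1 : \pi_quot_group 1 = 1 :> quot_group.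
Proof. by []. Qed.

Lemma quot_piM (x y : G) :
  \pi_quot_group (x * y) = (\pi_quot_group x : quot_group) * \pi_quot_group y.
Proof. by rewrite -quot_mulE. Qed.

Lemma quot_piV (x : G) :
  \pi_quot_group x^-1 = (\pi_quot_group x : quot_group)^-1.
Proof. by rewrite -quot_invE. Qed.

Section Induced.
Variable a : UMagmaMorphism.type G G.
Hypothesis aH : forall x : G, x \in (H : {pred G}) -> a x \in (H : {pred G}).

Definition quot_fun (c : quot_group) : quot_group := \pi_quot_group (a (repr c)).

Lemma quot_funE (x : G) : quot_fun (\pi_quot_group x) = \pi_quot_group (a x).
Proof.
apply/esym/quot_eqP.
by rewrite -gmulfV -gmulfM aH ?repr_quot.
Qed.

Fact quot_fun_monoid_morphism : monoid_morphism quot_fun.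
Proof.
split=> [|b c]; first by rewrite -quot_pi1 quot_funE gmulf1.
by rewrite -(reprK b) -(reprK c) -quot_piM !quot_funE gmulfM quot_piM.
Qed.

Definition quot_endo : UMagmaMorphism.type quot_group quot_group :=
  HB.pack quot_fun
    (isUMagmaMorphism.Build quot_group quot_group quot_fun
       quot_fun_monoid_morphism).

End Induced.

Fact quot_gensetP (T : genset G) :
  generates [fset \pi_quot_group x | x in genset_fset T]%fset predT.
Proof.
move=> c; split=> // _; have [w Tw wc] := (gensetP T (repr c)).1 isT.
exists [seq \pi_quot_group x | x <- w].
  rewrite /is_word all_map; apply: sub_all Tw => x /=.
  by case/orP=> Tx; apply/orP; [left|right; rewrite -quot_piV]; exact: in_imfset.
rewrite -[c]reprK -wc /word_val big_map.
by rewrite (big_morph _ quot_piM quot_pi1).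
Qed.

(* Finite generating sets of the quotient exist as soon as G has one. *)
Definition quot_genset (T : genset G) : genset quot_group :=
  Genset (quot_gensetP T).

End Quotient.

(* Main.v *)
Require Import Defs.
From mathcomp Require Import all_boot all_order all_algebra finmap.
From mathcomp Require Import all_classical all_reals all_analysis.

Set Implicit Arguments.
Unset Strict Implicit.
Unset Printing Implicit Defensive.

Import Order.TTheory GRing.Theory Num.Theory.
Import numFieldNormedType.Exports.

(** A group morphism is Lipschitz for word lengths: if [K] bounds the lengths of
    the images of the letters, the image of a word of [n] letters has length at
    most [K * n].  The canonical projection from [Gamma] onto the quotient
    intertwines [alpha] with the induced endomorphism, so each orbit in the
    quotient is the image of an orbit [alpha^m g], and its lengths exceed those
    of [alpha^m g] by at most the factor [K].  After taking m-th roots the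
    factor becomes [K`^(1/m)], which tends to 1 and so does not affect the
    limsup ([limn_esup_le_mul]).  Every element of the quotient has a
    representative, hence the inequality passes to the suprema.

    The argument applies to any pair of endomorphisms intertwined by a
    surjective morphism ([growth_rate_semiconj]).  As the generating sets of the
    source and of the target are unrelated, the identity morphism shows that
    growth rates do not depend on the choice of the generators. *)

Section WordLength.
Local Open Scope group_scope.

Lemma word_length_le (G : groupType) (T : genset G) (w : seq G) :
  is_word T w -> word_length T (word_val w) <= size w.
Proof.
by move=> Tw; rewrite /word_length; case: ex_minnP => m _; apply; apply/asboolP;
  exists w.
Qed.

Lemma word_length_witness (G : groupType) (T : genset G) (g : G) :
  exists w, [/\ is_word T w, word_val w = g & size w = word_length T g].
Proof. by rewrite /word_length; case: ex_minnP => m /asboolP. Qed.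

Lemma word_length1 (G : groupType) (T : genset G) : word_length T 1 = 0.
Proof.
apply/eqP; rewrite -leqn0; have := @word_length_le G T [::] isT.
by rewrite /word_val big_nil.
Qed.

Lemma word_lengthM (G : groupType) (T : genset G) (g h : G) :
  word_length T (g * h) <= word_length T g + word_length T h.
Proof.
have [u [Tu <- <-]] := word_length_witness T g.
have [v [Tv <- <-]] := word_length_witness T h.
have := @word_length_le G T (u ++ v); rewrite size_cat /word_val big_cat; apply.
by rewrite /is_word all_cat; apply/andP; split.
Qed.

(** Word length is subadditive, so a bound on the images of the finitely many
    letters is enough.  The constant is taken positive because its m-th roots
    must tend to 1. *)
Lemma word_length_lipschitz (G G' : groupType) (T : genset G) (S : genset G')
    (f : G -> G') (f1 : f 1 = 1) (fM : {morph f : x y / x * y}) :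
  exists2 K, 0 < K &
    forall g, word_length S (f g) <= K * word_length T g.
Proof.
(* A letter may be the inverse of a generator: both images are accounted for. *)
pose len x := word_length S (f x) + word_length S (f x^-1).
pose K := \sum_(x <- genset_fset T) len x.
have leK x : x \in genset_fset T -> len x <= K.
  by move=> Tx; rewrite /K (big_rem x)//= leq_addr.
exists K.+1 => // g; have [w [Tw <- <-]] := word_length_witness T g.
rewrite /word_val (big_morph f fM f1); elim: w Tw => [_|x w IHw /andP[Tx Tw]].
  by rewrite big_nil word_length1.
rewrite big_cons (leq_trans (word_lengthM _ _ _))//= mulnS leq_add ?IHw//.
apply/leqW; case/orP: Tx => /leK; apply: leq_trans; rewrite /len ?invgK.
  exact: leq_addr.
exact: leq_addl.
Qed.

End WordLength.

Section LimSup.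
Local Open Scope classical_set_scope.
Local Open Scope ring_scope.

Lemma cvg_root1 (R : realType) (a : R) :
  0 < a -> (a `^ (n%:R^-1)) @[n --> \oo] --> (1 : R).
Proof.
move=> a0; rewrite (_ : (fun n => _) = fun n => expR (n%:R^-1 * ln a)); last first.
  by apply/funext => n; rewrite /powR gt_eqF.
suff: expR (n%:R^-1 * ln a) @[n --> \oo] --> expR (0 * ln a).
  by rewrite mul0r expR0.
apply: continuous_cvg; first exact: continuous_expR.
apply: cvgMr_tmp; rewrite -cvg_shiftS.
exact: (@cvg_harmonic R).
Qed.

(** In the extended reals the product of the two upper limits is awkward at
    infinity; if the right-hand side is [+oo] there is nothing to prove, and
    otherwise it is a nonnegative real [L] and the bound [L + e] is shown for
    every [e > 0]. *)
Lemma limn_esup_le_mul (R : realType) (c u v : nat -> R) :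
    c @ \oo --> (1 : R) -> (forall n, 0 <= u n) ->
    (forall n, v n <= c n * u n) ->
  (limn_esup (fun n => (v n)%:E) <= limn_esup (fun n => (u n)%:E))%E.
Proof.
move=> c1 u0 vcu.
have L0 : (0 <= limn_esup (fun n => (u n)%:E))%E.
  apply: limf_esup_ge0 => [|n]; last by rewrite lee_fin.
  by move=> [N _ /(_ N)]; apply; rewrite /=.
move: L0; case EL : (limn_esup (fun n => (u n)%:E)) => [L| |] //; last first.
  by move=> _; exact: leey.
rewrite lee_fin => L0.
apply/lee_addgt0Pr => e e0.
(* Eventually [u < L + e/2] and [c (L + e/2) < L + e], as [c] tends to 1. *)
have e20 : 0 < e / 2 by rewrite divr_gt0.
have : (limn_esup (fun n => (u n)%:E) < (L + e / 2)%:E)%E.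
  by rewrite EL lte_fin ltrDl.
move=> /ereal_inf_lt[_ [A Aoo <-]] supA.
have c_lt : \forall n \near \oo, c n < (L + e) / (L + e / 2).
  apply: (cvgr_lt (1 : R)) => //.
  rewrite ltr_pdivlMr ?mul1r ?ltrD2l ?ltr_wpDl//.
  by rewrite ltr_pdivrMr// ltr_pMr// ltr1n.
have ABoo := filterI Aoo c_lt.
apply: ge_ereal_inf; eexists; first by eexists; first exact: ABoo.
apply: ge_ereal_sup => _ [n [An cn] <-]; rewrite lee_fin.
have uL : u n < L + e / 2.
  rewrite -lte_fin; apply: le_lt_trans supA; apply: ereal_sup_ubound.
  by exists n.
apply: le_trans (vcu n) _.
have Le0 : 0 < L + e / 2 by rewrite ltr_wpDl.
have q0 : 0 <= (L + e) / (L + e / 2) by rewrite divr_ge0 ?addr_ge0// ltW.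
apply: (@le_trans _ _ ((L + e) / (L + e / 2) * u n)).
  by rewrite ler_wpM2r// ltW.
apply: (@le_trans _ _ ((L + e) / (L + e / 2) * (L + e / 2))).
  by rewrite ler_wpM2l// ltW.
by rewrite divfK// gt_eqF.
Qed.

End LimSup.

Section GrowthRate.
Local Open Scope group_scope.

Lemma growth_rate_semiconj (R : realType) (G G' : groupType)
    (T : genset G) (S : genset G')
    (a : UMagmaMorphism.type G G) (b : UMagmaMorphism.type G' G')
    (f : G -> G') (f1 : f 1 = 1) (fM : {morph f : x y / x * y})
    (f_surj : forall y, exists x, f x = y) (fab : {morph f : x / a x >-> b x}) :
  (growth_rate R S b <= growth_rate R T a)%E.
Proof.
have [K K0 leK] := word_length_lipschitz T S f1 fM.
apply: ge_ereal_sup => _ [y _ <-]; have [g <-] := f_surj y.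
apply: le_ereal_sup_tmp; eexists; first by exists g.
have fabm m : iter m b (f g) = f (iter m a g).
  by elim: m => //= m ->; rewrite fab.
apply: (@limn_esup_le_mul R (fun m => (K%:R `^ (m%:R^-1))%R)) => [|m|m].
- by apply: cvg_root1; rewrite ltr0n.
- exact: powR_ge0.
- rewrite -powRM// -natrM ge0_ler_powR ?nnegrE ?invr_ge0//.
  by rewrite ler_nat fabm.
Qed.

End GrowthRate.

Theorem lemma3p1 (R : realType) (Gamma : groupType) (H : normalSubgroup Gamma)
    (Hfg : finitely_generated H) (alpha : UMagmaMorphism.type Gamma Gamma)
    (alphaH : forall x : Gamma, x \in (H : {pred Gamma}) ->
              alpha x \in (H : {pred Gamma}))
    (T : genset Gamma) (S : genset (quot_group H)) :
  (growth_rate R S (quot_endo alphaH) <= growth_rate R T alpha)%E.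
Proof.
apply: (growth_rate_semiconj R T S
  (f := fun x => (\pi_(quot_group H)%qT x : quot_group H))).
- exact: quot_pi1.
- exact: quot_piM.
- by move=> c; exists (repr c); rewrite reprK.
- by move=> x; rewrite -quot_funE.
Qed.
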